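(* Let $\mathcal{G}$ be a (Gromov) hyperbolic connected metric graph, not necessarily locally finite, which is hyperbolic relative to a family $\mathcal{H}=\{H_c\mid c\in\mathcal{C}\}$ of complete connected subgraphs, and let $\mathcal{EG}$ be the $\mathcal{H}$-electrification of $\mathcal{G}$. Assume that there is a number $\delta>0$ such that each $H_c$ $(c\in\mathcal{C})$, equipped with its intrinsic path metric, is $\delta$-hyperbolic. If the collection $\{H_c\mid c\in\mathcal{C}\}$ has asymptotic dimension at most $n$ uniformly, then \[\mathrm{asdim}(\mathcal{G})\leq \mathrm{asdim}(\mathcal{EG})+n+1.\]
   Context: All graphs are metric graphs with edges of length one, with the path metric. A subgraph is complete if any two of its vertices which are joined by an edge in the ambient graph are joined by an edge in the subgraph. The index set $\mathcal{C}$ is countable, finite or empty. Each $H_c$ carries its intrinsic path metric. Asymptotic dimension: a metric space $X$ has $\mathrm{asdim}(X)\leq n$ if for every $R>0$ there is a covering of $X$ by sets of uniformly bounded diameter such that every metric $R$-ball intersects at most $n+1$ of the sets of the cover; $\mathrm{asdim}(X)$ is the smallest such $n$ (or $\infty$). A collection of metric spaces has $\mathrm{asdim}\leq n$ uniformly if for every $R>0$ there is a number $D(R)$ such that each space of the collection has a cover by sets of diameter at most $D(R)$ with every $R$-ball meeting at most $n+1$ of them. Electrification: $\mathcal{EG}$ is the graph obtained from $\mathcal{G}$ by adding, for every $c\in\mathcal{C}$, a new vertex $v_c$ which is connected by an edge to each vertex of $H_c$ and to no other vertex. Relative hyperbolicity: $\mathcal{G}$ is hyperbolic relative to the family $\mathcal{H}$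 of complete connected subgraphs if $\mathcal{EG}$ is Gromov hyperbolic and the following bounded penetration property holds. A simplicial path $\gamma$ in $\mathcal{EG}$ (parametrized by integers) is efficient if for every $c\in\mathcal{C}$ we have $\gamma(k)=v_c$ for at most one $k$. For every $L>1$ there is a number $p(L)>0$ such that: if $\gamma$ is an efficient $L$-quasi-geodesic in $\mathcal{EG}$, $c\in\mathcal{C}$, $\gamma(k)=v_c$, and the distance in $H_c$ between $\gamma(k-1)$ and $\gamma(k+1)$ is at least $p(L)$, then every efficient $L$-quasi-geodesic $\gamma'$ in $\mathcal{EG}$ with the same endpoints as $\gamma$ passes through $v_c$, and if $\gamma'(k')=v_c$ then the distances in $H_c$ between $\gamma(k-1)$ and $\gamma'(k'-1)$ and between $\gamma(k+1)$ and $\gamma'(k'+1)$ are at most $p(L)$. *)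

(* Defs.v *)
From mathcomp Require Import all_boot all_order all_algebra.
From mathcomp Require Import all_classical all_reals all_analysis.

Set Implicit Arguments.
Unset Strict Implicit.
Unset Printing Implicit Defensive.

Import Order.TTheory GRing.Theory Num.Theory.

Local Open Scope classical_set_scope.
Local Open Scope card_scope.
Local Open Scope ring_scope.

(* Multiple edges and loops are allowed; the orientation of an edge only serves
   to parametrize it by the unit interval. *)
Record graph := Graph {
  vert : Type;
  edge : Type;
  src : edge -> vert;
  tgt : edge -> vert
}.

Definition adjacent (G : graph) (u v : vert G) : Prop :=
  exists e : edge G, (src e = u /\ tgt e = v) \/ (src e = v /\ tgt e = u).

(* Only the values g 0, ..., g m matter. *)
Definition simplicial_path (G : graph) (g : nat -> vert G) (m : nat) : Prop :=
  forall i : nat, (i < m)%N -> adjacent (g i) (g i.+1).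

Definition connected_graph (G : graph) : Prop :=
  inhabited (vert G) /\
  forall u v : vert G, exists (g : nat -> vert G) (m : nat),
    [/\ simplicial_path g m, g 0%N = u & g m = v].

Inductive gpoint (R : realType) (G : graph) : Type :=
| Vtx of vert G
| Inner (e : edge G) (t : R) of 0 < t < 1.

Variant at_param (R : realType) (G : graph) (e : edge G) :
    R -> gpoint R G -> Prop :=
| AtSrc : at_param e 0 (Vtx R (src e))
| AtTgt : at_param e 1 (Vtx R (tgt e))
| AtInner (t : R) (ht : 0 < t < 1) : at_param e t (Inner e ht).

(* [pl_path x y l]: there is a piecewise linear path of length [l] from [x] to
   [y], i.e. a concatenation of finitely many segments, each contained in one
   closed edge. *)
Inductive pl_path (R : realType) (G : graph) :
    gpoint R G -> gpoint R G -> R -> Prop :=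
| PLNil x : pl_path x x 0
| PLCons (e : edge G) (s t : R) x y z (l : R) :
    at_param e s x -> at_param e t y -> pl_path y z l ->
    pl_path x z (`|s - t| + l).

(* The path metric; meaningful on connected graphs only. *)
Definition gdist (R : realType) (G : graph) (x y : gpoint R G) : R :=
  inf [set l | pl_path x y l].

Record subgraph (G : graph) := Subgraph {
  svert : set (vert G);
  sedge : set (edge G);
  sedge_src : forall e : edge G, e \in sedge -> src e \in svert;
  sedge_tgt : forall e : edge G, e \in sedge -> tgt e \in svert
}.

Definition graph_of_subgraph (G : graph) (H : subgraph G) : graph :=
  @Graph (set_type (svert H)) (set_type (sedge H))
    (fun e => exist _ (src (sval e)) (sedge_src (svalP e)))
    (fun e => exist _ (tgt (sval e)) (sedge_tgt (svalP e))).

Coercion graph_of_subgraph : subgraph >-> graph.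

Definition complete_subgraph (G : graph) (H : subgraph G) : Prop :=
  forall u v : vert H, adjacent (sval u) (sval v) -> adjacent u v.

(* The vertex [inr c] is the cone vertex v_c; the edge [inr (c; v)] joins the
   vertex v of H_c to v_c. *)
Definition electrification (G : graph) (C : Type) (H : C -> subgraph G) :
    graph :=
  @Graph (vert G + C)%type (edge G + {c : C & vert (H c)})%type
    (fun e => match e with
              | inl e0 => inl (src e0)
              | inr p => inl (sval (projT2 p))
              end)
    (fun e => match e with
              | inl e0 => inl (tgt e0)
              | inr p => inr (projT1 p)
              end).

Definition gromov_product (R : realType) (X : Type) (d : X -> X -> R)
    (w x y : X) : R :=
  (d x w + d y w - d x y) / 2.

Definition hyperbolic_with (R : realType) (X : Type) (d : X -> X -> R)
    (delta : R) : Prop :=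
  forall w x y z : X,
    Num.min (gromov_product d w x y) (gromov_product d w y z) - delta
      <= gromov_product d w x z.

Definition gromov_hyperbolic (R : realType) (X : Type) (d : X -> X -> R) :
    Prop :=
  exists2 delta : R, 0 < delta & hyperbolic_with d delta.

Definition quasi_geodesic (R : realType) (G : graph) (L : R)
    (g : nat -> vert G) (m : nat) : Prop :=
  forall i j : nat, (i <= j <= m)%N ->
    (j - i)%:R / L - L <= gdist (Vtx R (g i)) (Vtx R (g j))
      <= L * (j - i)%:R + L.

Section RelativeHyperbolicity.
Variables (R : realType) (G : graph) (C : Type) (H : C -> subgraph G).
Local Notation EG := (electrification H).

Definition efficient (g : nat -> vert EG) (m : nat) : Prop :=
  forall (c : C) (i j : nat), (i <= m)%N -> (j <= m)%N ->
    g i = inr c -> g j = inr c -> i = j.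

Definition efficient_quasi_geodesic (L : R) (g : nat -> vert EG) (m : nat) :
    Prop :=
  [/\ simplicial_path g m, efficient g m & quasi_geodesic L g m].

(* [k.+1] and [k'.+1] are the times of passage through v_c; the neighbours of
   v_c in EG are exactly the vertices of H_c. Since the paths are efficient and
   have the same endpoints, and g meets v_c at an interior time, g' can meet v_c
   at interior times only. *)
Definition bounded_penetration : Prop :=
  forall L : R, 1 < L -> exists2 p : R, 0 < p &
  forall (g : nat -> vert EG) (m : nat) (c : C) (k : nat) (a b : vert (H c)),
    efficient_quasi_geodesic L g m ->
    (k.+2 <= m)%N ->
    g k = inl (sval a) -> g k.+1 = inr c -> g k.+2 = inl (sval b) ->
    p <= gdist (Vtx R a) (Vtx R b) ->
  forall (g' : nat -> vert EG) (m' : nat),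
    efficient_quasi_geodesic L g' m' ->
    g' 0%N = g 0%N -> g' m' = g m ->
    (exists2 k' : nat, (k' <= m')%N & g' k' = inr c) /\
    (forall (k' : nat) (a' b' : vert (H c)), (k'.+2 <= m')%N ->
       g' k' = inl (sval a') -> g' k'.+1 = inr c ->
       g' k'.+2 = inl (sval b') ->
       gdist (Vtx R a) (Vtx R a') <= p /\ gdist (Vtx R b) (Vtx R b') <= p).

Definition relatively_hyperbolic : Prop :=
  gromov_hyperbolic (@gdist R EG) /\ bounded_penetration.

End RelativeHyperbolicity.

Section AsymptoticDimension.
Variable R : realType.

Definition asdim_cover (X : Type) (d : X -> X -> R) (n : nat) (r D : R) :
    Prop :=
  exists U : set (set X),
    [/\ \bigcup_(A in U) A = [set: X],
        forall A : set X, U A -> forall x y : X, A x -> A y -> d x y <= D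
      & forall x : X,
          [set A | U A /\ A `&` [set y | d x y < r] !=set0] #<= `I_n.+1].

Definition asdim_le (X : Type) (d : X -> X -> R) (n : nat) : Prop :=
  forall r : R, 0 < r -> exists D : R, asdim_cover d n r D.

Definition uniform_asdim_le (C : Type) (X : C -> Type)
    (d : forall c : C, X c -> X c -> R) (n : nat) : Prop :=
  forall r : R, 0 < r -> exists D : R, forall c : C, asdim_cover (d c) n r D.

(* The infimum of the empty set is +oo. *)
Definition asdim (X : Type) (d : X -> X -> R) : \bar R :=
  ereal_inf [set (n%:R)%:E | n in [set n : nat | asdim_le d n]].

End AsymptoticDimension.

(* Main.v *)
Require Import Defs.
From mathcomp Require Import all_boot all_order all_algebra.
From mathcomp Require Import all_classical all_reals all_analysis.
From mathcomp Require Import lra.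

Set Implicit Arguments.
Unset Strict Implicit.
Unset Printing Implicit Defensive.

Import Order.TTheory GRing.Theory Num.Theory.

Local Open Scope classical_set_scope.
Local Open Scope ring_scope.

(* A colouring at scale [r] assigns to every point some of [k] colours so that
   the [r]-chains of one colour are bounded.  Asymptotic dimension at most [n]
   means that for every [k] and [r] there is such a colouring missing at most
   [n] colours at each point.

   The balls of EG, seen in G, have asymptotic dimension at most [n] uniformly,
   by induction on the radius: the ball of radius [j + 1] is contained in a
   neighbourhood of the ball of radius [j] together with the subgraphs H_c whose
   cone vertex lies in that ball.  Every path of bounded length is a
   quasi-geodesic, so bounded penetration shows that the H_c are uniformly
   coarsely embedded and that, far from the ball of radius [j], distinct ones
   are far apart.  A Hurewicz argument for the inclusion of G in EG then gives
   asdim(G) <= asdim(EG) + n: with [m + n + 1] colours, at most [m] are missing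
   in the base and at most [n] in the fibres, so that one remains. *)

Definition pseudometric (R : realType) (X : Type) (d : X -> X -> R) : Prop :=
  [/\ forall x, d x x = 0, forall x y, d x y = d y x
    & forall x y z, d x z <= d x y + d y z].

(** * Chains and colourings *)

Section Coarse.
Variables (R : realType) (X : Type) (d : X -> X -> R).

Inductive chain (r : R) (W : set X) : X -> X -> Prop :=
| ChainNil x : W x -> chain r W x x
| ChainCons x y z : W x -> d x y <= r -> chain r W y z -> chain r W x z.

Definition bounded_chains (r D : R) (W : set X) : Prop :=
  forall x y, chain r W x y -> d x y <= D.

Definition colours (k n : nat) (A : set X) (W : 'I_k -> set X) : Prop :=
  forall x, A x -> (#|[pred i | ~~ `[< W i x >]]| <= n)%N.

Lemma chain_startW r W x y : chain r W x y -> W x.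
Proof. by case. Qed.

Lemma chain_endW r W x y : chain r W x y -> W y.
Proof. by elim. Qed.

Lemma chain_trans r W x y z : chain r W x y -> chain r W y z -> chain r W x z.
Proof.
by move=> xy yz; elim: xy yz => // u v w Wu uv _ IH /IH; apply: ChainCons.
Qed.

Lemma chain1 r (W : set X) x y : W x -> W y -> d x y <= r -> chain r W x y.
Proof. by move=> Wx Wy xy; apply: (ChainCons Wx xy); apply: ChainNil. Qed.

Lemma sub_chain r s (W V : set X) x y :
  r <= s -> W `<=` V -> chain r W x y -> chain s V x y.
Proof.
move=> rs WV; elim=> [u /WV|u v w /WV Vu uv _ IH]; first exact: ChainNil.
by apply: ChainCons IH => //; apply: le_trans uv rs.
Qed.

Hypothesis dP : pseudometric d.

Lemma pseudometric_ge0 x y : 0 <= d x y.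
Proof. by case: dP => d0 ds dt; have := dt x y x; rewrite d0 (ds y x); lra. Qed.

Lemma chain_sym r W x y : chain r W x y -> chain r W y x.
Proof.
case: dP => _ ds _; elim=> [u|u v w Wu uv vw wv]; first exact: ChainNil.
apply: (chain_trans wv); apply: chain1 => //; last by rewrite ds.
exact: chain_startW vw.
Qed.

(** An [r]-chain in the union alternates between runs in [A], of diameter at most [DA], and visits
    to [B]. Successive visits are at most [DA + 2 * r] apart, so they form a chain in [B]; the ends
    lie within [DA + r] of the first and last visit. *)
Lemma bounded_chainsU r DA DB (A B : set X) :
  0 <= r -> 0 <= DA -> 0 <= DB ->
  bounded_chains r DA A -> bounded_chains (DA + 2 * r) DB B ->
  bounded_chains r (DB + 2 * (DA + r)) (A `|` B).
Proof.
case: dP => d0 ds dt r0 DA0 DB0 hA hB x z xz.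
(* Here [b] and [b'] stand for the first and the last visit to [B]; a chain without visits stays in
   [A]. *)
suff: chain r A x z \/ exists b b',
    [/\ chain (DA + 2 * r) B b b',
        x = b \/ (exists2 a, chain r A x a & d a b <= r)
      & b' = z \/ (exists2 a, d b' a <= r & chain r A a z)].
  case=> [/hA|[b [b' [/hB bb' xb bz]]]]; first lra.
  have : d x b <= DA + r.
    case: xb => [->|[a /hA xa ab]]; first by rewrite d0; lra.
    by have := dt x a b; lra.
  have : d b' z <= DA + r.
    case: bz => [->|[a b'a /hA az]]; first by rewrite d0; lra.
    by have := dt b' a z; lra.
  by have := dt x b z; have := dt b b' z; lra.
elim: xz => [u [Au|Bu]|u v w ABu uv _ IH].
- by left; apply: ChainNil.
- by right; exists u, u; split; [apply: ChainNil|left|left].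
- case: ABu => [Au|Bu]; case: IH => [vw|[b [b' [bb' vb bw]]]].
  + by left; apply: ChainCons vw.
  + right; exists b, b'; split=> //; right.
    case: vb => [<-|[a va ab]]; first by exists u => //; apply: ChainNil.
    by exists a => //; apply: ChainCons va.
  + right; exists u, u; split; [exact: ChainNil|by left|right].
    by exists v.
  + right; exists u, b'; split; [|by left|by []].
    apply: ChainCons bb' => //.
    case: vb => [<-|[a /hA va ab]]; first lra.
    by have := dt u v b; have := dt v a b; lra.
Qed.

Definition thickening (t : R) (W : set X) : set X :=
  [set x | exists2 y, W y & d x y <= t].

(** Replacing each point of a chain by a point of [W] within [t] changes every distance by at most
    [2 * t]. *)
Lemma bounded_chains_thickening r t D W :
  bounded_chains (r + 2 * t) D W ->
  bounded_chains r (D + 2 * t) (thickening t W).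
Proof.
case: dP => d0 ds dt hW x z xz.
suff: exists a b, [/\ d x a <= t, d z b <= t & chain (r + 2 * t) W a b].
  move=> [a [b [xa zb /hW ab]]].
  by have := dt x a z; have := dt a b z; rewrite (ds b z); lra.
elim: xz => [u [a Wa ua]|u v w [a Wa ua] uv _ [b [c [vb wc bc]]]].
  by exists a, a; split=> //; apply: ChainNil.
exists a, c; split=> //; apply: ChainCons bc => //.
by have := dt a u b; have := dt u v b; rewrite (ds a u); lra.
Qed.

End Coarse.

Arguments chain_startW {R X d r W x y}.
Arguments chain_endW {R X d r W x y}.

Lemma sub_colours (X Y : Type) k n (A : set X) (B : set Y)
    (W : 'I_k -> set X) (V : 'I_k -> set Y) :
  (forall y, B y -> exists2 x, A x & forall i, W i x -> V i y) ->
  colours n A W -> colours n B V.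
Proof.
move=> BA AW y /BA [x Ax WV]; apply: leq_trans (AW x Ax).
apply: subset_leq_card; apply/fintype.subsetP => i; rewrite !inE.
by apply: contra => /asboolP /WV ?; apply/asboolP.
Qed.

(* For [F = [set setT]] and [k = n + 1] this says that the asymptotic dimension
   is at most [n]. *)
Definition colourable (R : realType) (X : Type) (d : X -> X -> R) (k n : nat)
    (F : set (set X)) : Prop :=
  forall r, 0 <= r -> exists2 D, 0 <= D & forall A, F A ->
    exists2 W : 'I_k -> set X, colours n A W
      & forall i, bounded_chains d r D (W i).

(** * Covers versus colourings *)

Section CoverColour.
Variables (R : realType) (X : Type) (d : X -> X -> R).
Hypothesis dP : pseudometric d.

(* The members of the cover met by the ball of radius [rho] about a point grow
   with [rho]; colour [i] collects the points for which nothing is gained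
   between the radii [(i + 1) r] and [(i + 2) r].  At most [n] colours are
   missed, and the members met are constant along an [r]-chain of one colour. *)
Lemma asdim_cover_colours (n k : nat) (r D : R) : 0 < r ->
  asdim_cover d n (k.+1%:R * r) D ->
  exists2 W : 'I_k -> set X, colours n setT W
    & forall i, bounded_chains d r (D + 2 * (k.+1%:R * r)) (W i).
Proof.
case: dP => d0 ds dt r0 [U [Ucov Udiam Umult]].
pose S x rho : set (set X) :=
  [set A | U A /\ A `&` [set y | d x y < rho] !=set0].
have SS x rho rho' : rho <= rho' -> S x rho `<=` S x rho'.
  move=> le A [UA [y [Ay xy]]]; split=> //; exists y; split=> //=.
  exact: lt_le_trans xy le.
have Sne x : exists A, S x (1%:R * r) A.
  have : [set: X] x by [].
  rewrite -Ucov => -[A UA Ax]; exists A; split=> //; exists x; split=> //=.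
  by rewrite d0; lra.
have Smv x y (i : nat) : d x y <= r -> S y (i%:R * r) `<=` S x (i.+1%:R * r).
  move=> xy A [UA [z [Az yz]]]; split=> //; exists z; split=> //=.
  move: yz => /= yz; have := dt x y z; rewrite -natr1; lra.
have le_r (i j : nat) : (i <= j)%N -> i%:R * r <= j%:R * r.
  by move=> ij; rewrite ler_pM2r // ler_nat.
exists (fun i : 'I_k => [set x | S x (i.+2%:R * r) `<=` S x (i.+1%:R * r)]).
  move=> x _.
  have /pcard_leP[f] := Umult x.
  pose bad := [pred i : 'I_k |
    ~~ `[< S x (i.+2%:R * r) `<=` S x (i.+1%:R * r) >]].
  have /choice[A hA] (i : 'I_k) : exists B, bad i ->
      S x (i.+2%:R * r) B /\ ~ S x (i.+1%:R * r) B.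
    case: (boolP (bad i)) => [/asboolPn nS|_]; last by exists set0.
    apply: contrapT => nE; apply: nS => B SB.
    by apply: contrapT => nSB; apply: nE; exists B.
  have [A0 SA0] := Sne x.
  have kS (B : set X) (j : nat) : (j <= k.+1)%N -> S x (j%:R * r) B ->
      S x (k.+1%:R * r) B by move=> jk; apply: SS; apply: le_r.
  have flt B : S x (k.+1%:R * r) B -> (f B < n.+1)%N.
    by move=> SB; have := @funS _ _ _ _ f B SB.
  have finj B B' : S x (k.+1%:R * r) B -> S x (k.+1%:R * r) B' ->
      f B = f B' -> B = B'.
    by move=> SB SB'; apply: (@inj _ _ _ f); apply/mem_set.
  have AS i : bad i -> S x (k.+1%:R * r) (A i).
    by move=> /hA [SAi _]; apply: kS SAi; rewrite ltnS.
  have ltA (i j : 'I_k) : bad i -> bad j -> (i < j)%N -> A i <> A j.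
    move=> /hA [Si _] /hA [_ nSj] ij Aij; apply: nSj; rewrite -Aij.
    by apply: SS Si; apply: le_r.
  (* [A0] is met already at radius [r], and each missed colour [i] contributes a member [A i] first
     met at a later stage. These members are distinct and [f] numbers them below [n + 1], so at most
     [n] colours are missed. *)
  pose s := f A0 :: [seq f (A i) | i <- enum bad].
  have us : uniq s.
    rewrite /= map_inj_in_uniq ?enum_uniq ?andbT.
      apply/negP => /mapP [i]; rewrite mem_enum => bi /finj AA.
      have [_ []] := hA i bi; rewrite -AA; [|exact: kS SA0|exact: AS].
      by apply: SS SA0; apply: le_r.
    move=> i j; rewrite !mem_enum => bi bj /finj AA.
    have {}AA := AA (AS _ bi) (AS _ bj).
    case: (ltngtP i j) => [ij|ji|/val_inj //].
      by have := ltA _ _ bi bj ij.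
    by have := ltA _ _ bj bi ji; rewrite AA.
  suff /(uniq_leq_size us) : {subset s <= iota 0 n.+1}.
    by rewrite size_iota /= size_map -cardE ltnS.
  move=> z; rewrite in_cons mem_iota add0n => /orP [/eqP ->|/mapP [i]].
    by apply: flt; apply: kS SA0.
  by rewrite mem_enum => bi ->; apply: flt; apply: AS.
move=> i x y xy.
(* A step from [u] to [v] costs one [r] in the radius, and the colour of [v] says that this larger
   radius gains nothing at [v]. *)
have Sxy : S x (i.+1%:R * r) `<=` S y (i.+1%:R * r).
  elim: xy => [u _|u v w Wu uv vw IH]; first exact: subset_refl.
  apply: subset_trans IH.
  apply: (@subset_trans _ (S v (i.+2%:R * r))).
    by apply: Smv; rewrite ds.
  exact: chain_startW vw.
have [A SA] := Sne x.
have {}SA : S x (i.+1%:R * r) A by apply: SS SA; apply: le_r.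
have [_ [b [Ab /= yb]]] := Sxy _ SA.
have [UA [a [Aa /= xa]]] := SA.
have ab := Udiam A UA a b Aa Ab.
have ik : i.+1%:R * r <= k.+1%:R * r by apply: le_r; rewrite ltnS ltnW.
by have := dt x a y; have := dt a b y; rewrite (ds b y); lra.
Qed.

(** The cover consists of the [2 * r]-chain components of the colours. Points of an [r]-ball are
    less than [2 * r] apart, so the ball meets at most one component of each colour. *)
Lemma colours_asdim_cover (n : nat) (r D : R) (W : 'I_n.+1 -> set X) :
  0 < r -> colours n setT W -> (forall i, bounded_chains d (2 * r) D (W i)) ->
  asdim_cover d n r D.
Proof.
case: (dP) => d0 ds dt r0 Wc Wb.
have r20 : 0 <= 2 * r by lra.
exists [set A | exists i x, W i x /\ A = chain d (2 * r) (W i) x].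
split.
- apply/seteqP; split=> // x _.
  have [i Wix] : exists i, W i x.
    apply: contrapT => nW; have := Wc x I; rewrite (@eq_card _ _ predT).
      by rewrite card_ord ltnn.
    by move=> i; rewrite !inE; apply/asboolPn => Wix; apply: nW; exists i.
  by exists (chain d (2 * r) (W i) x); [exists i, x|apply: ChainNil].
- move=> _ [i [x0 [Wx0 ->]]] x y x0x x0y; apply: (Wb i).
  exact: chain_trans (chain_sym dP x0x) x0y.
- move=> x.
  (* [F j] is the only component of colour [j] that the ball can meet, or empty. *)
  pose F (j : nat) : set X := [set y | exists2 z,
    d x z < r & chain d (2 * r) (W (inord j)) z y].
  apply: card_le_trans (card_image_le F `I_n.+1).
  apply: subset_card_le => _ [[i [x0 [Wx0 ->]]] [z [x0z /= xz]]].
  exists (val i) => /=; first exact: ltn_ord.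
  apply/seteqP; split=> y; rewrite /F inord_val /=.
    move=> [t xt ty]; apply: (chain_trans x0z); apply: ChainCons ty.
      exact: chain_endW x0z.
    by have := dt z x t; rewrite (ds z x); lra.
  by move=> x0y; exists z => //; apply: chain_trans (chain_sym dP x0z) x0y.
Qed.

End CoverColour.

(** * A Hurewicz theorem for colourings *)

Lemma chain_in_component (R : realType) (X : Type) (d : X -> X -> R) r W x y :
  chain d r W x y -> chain d r (W `&` chain d r W x) x y.
Proof.
move=> xy; have xx : chain d r W x x by apply: ChainNil (chain_startW xy).
move: xx; move: {1 3}x => w; elim: xy => [u Wu|u v z Wu uv vz IH] wu.
  by apply: ChainNil.
apply: ChainCons (IH _) => //; apply: (chain_trans wu).
by apply: chain1 => //; apply: chain_startW vz.
Qed.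

Lemma coloursI (X : Type) k m n (A : set X) (P Q : 'I_k -> set X) :
  colours m A P -> colours n A Q ->
  colours (m + n) A (fun i => P i `&` Q i).
Proof.
move=> hP hQ x Ax; apply: leq_trans (leq_add (hP x Ax) (hQ x Ax)).
rewrite -cardUI; apply: leq_trans (leq_addr _ _).
apply: subset_leq_card; apply/fintype.subsetP => i; rewrite !inE.
by rewrite -negb_and -asbool_and.
Qed.

Section Hurewicz.
Variables (R : realType) (X : Type) (d e : X -> X -> R) (m n : nat).
Hypotheses (dP : pseudometric d) (eP : pseudometric e).
Hypothesis le_ed : forall x y, e x y <= d x y.
Let k := (m + n).+1.
Let diam_le E : set (set X) := [set Z | forall x y, Z x -> Z y -> e x y <= E].
Hypothesis base : forall k', colourable e k' m [set setT].
Hypothesis fibres : forall E, colourable d k n (diam_le E).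

(** The [Delta]-chain components of [V] are coloured independently. A set of [e]-diameter at most
    [Delta] meets only one of them, so chains inside it see a single fibre colouring. *)
Lemma fibre_colouring1 Delta E s (V : set X) : 0 <= s ->
  bounded_chains e Delta E V ->
  exists2 D, 0 <= D & exists2 Q : 'I_k -> set X, colours n V Q
    & forall i U, diam_le Delta U -> bounded_chains d s D (Q i `&` U).
Proof.
move=> s0 Vb; have [D D0 hD] := fibres E s0; exists D => //.
(* Sets of [e]-diameter above [E] get empty colours as a default. *)
have /choice[W hW] (Z : set X) : exists W : 'I_k -> set X, diam_le E Z ->
    colours n Z W /\ forall i, bounded_chains d s D (W i).
  have [/hD[W ? ?]|nZ] := pselect (diam_le E Z); first by exists W.
  by exists (fun=> set0) => /nZ.
pose Z x := chain e Delta V x.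
have ZE x : diam_le E (Z x).
  by move=> y z xy xz; apply: Vb; apply: chain_trans (chain_sym eP xy) xz.
exists (fun i => [set x | V x /\ W (Z x) i x]).
  move=> x Vx; have [Wc _] := hW _ (ZE x).
  suff /(_ x erefl) : colours n [set x] (fun i => [set x | V x /\ W (Z x) i x]).
    by [].
  apply: sub_colours Wc => _ ->; exists x; [exact: ChainNil|by split].
move=> i U UD x y xy; have [_ Wb] := hW _ (ZE x); apply: (Wb i).
have [[Vx _] Ux] := chain_startW xy.
apply: sub_chain xy => // z [[Vz Wz] Uz].
suff -> : Z x = Z z by [].
by apply/seteqP; split=> t; apply: chain_trans; apply: chain1 => //; apply: UD.
Qed.

(** Induction on the number of sets: the union with the colouring of the first set keeps chains
    bounded if the other sets are coloured at the larger scale [D1 + 2 * s]. *)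
Lemma fibre_colouring Delta E (l : nat) (V : 'I_l -> set X) :
  (forall i, bounded_chains e Delta E (V i)) ->
  forall s, 0 <= s ->
  exists2 D, 0 <= D & exists2 Q : 'I_k -> set X,
    colours n [set x | exists j, V j x] Q
    & forall i U, diam_le Delta U -> bounded_chains d s D (Q i `&` U).
Proof.
elim: l V => [|l IH] V Vb s s0.
  exists 0 => //; exists (fun=> set0) => [x [[]] //|i U _ x y].
  by move=> /chain_startW [].
have [D1 D10 [Q1 Q1c Q1b]] := fibre_colouring1 s0 (Vb ord0).
have s'0 : 0 <= D1 + 2 * s by lra.
have [D2 D20 [Q2 Q2c Q2b]] := IH (fun i => V (lift ord0 i))
  (fun i => Vb (lift ord0 i)) _ s'0.
exists (D2 + 2 * (D1 + s)); first lra.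
exists (fun i => Q1 i `|` Q2 i).
  move=> x [j Vjx]; case: (unliftP ord0 j) Vjx => [j' ->|->] Vx.
    suff /(_ x (ex_intro _ j' Vx)) : colours n [set x | exists j,
      V (lift ord0 j) x] (fun i => Q1 i `|` Q2 i) by [].
    by apply: sub_colours Q2c => y Vy; exists y => // i; right.
  suff /(_ x Vx) : colours n (V ord0) (fun i => Q1 i `|` Q2 i) by [].
  by apply: sub_colours Q1c => y Vy; exists y => // i; left.
move=> i U UD; rewrite setIUl.
by apply: bounded_chainsU => //; [exact: Q1b|exact: Q2b].
Qed.

(** [P] colours the base at scale [r]. As [e <= d], a [d]-chain inside [P i] stays in a set of
    [e]-diameter at most [Delta], and there colour [i] of the fibre colouring [Q] has bounded
    chains. Hence the intersections of [P] and [Q] serve as colours. *)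
Lemma hurewicz : colourable d k (m + n) [set setT].
Proof.
move=> r r0; have [Delta D0 /(_ _ erefl)[P Pc Pb]] := base k r0.
(* At most [m] of these [m + 1] colours are missed, so the sets [V j] cover the space. *)
have [E E0 /(_ _ erefl)[V Vc Vb]] := base m.+1 D0.
have [D D'0 [Q Qc Qb]] := fibre_colouring Vb r0.
exists D => // _ ->; exists (fun i => P i `&` Q i).
  apply: coloursI => // x _; apply: Qc; apply: contrapT => nV.
  have := Vc x I; rewrite (@eq_card _ _ predT).
    by rewrite card_ord ltnn.
  by move=> j; rewrite !inE; apply/asboolPn => Vx; apply: nV; exists j.
move=> i x y xy; have {}xy := chain_in_component xy.
apply: (Qb i (chain e r (P i) x)).
  by move=> u v xu xv; apply: Pb; apply: chain_trans (chain_sym eP xu) xv.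
apply: sub_chain xy => // z [[Pz Qz] xz]; split=> //.
elim: xz => [u [Pu _]|u v w [Pu _] uv _ IH]; first exact: ChainNil.
by apply: ChainCons IH => //; apply: le_trans uv.
Qed.

End Hurewicz.

(** * The path metric of a graph *)

Definition walk (G : graph) (m : nat) (u v : vert G) : Prop :=
  exists g : nat -> vert G, [/\ simplicial_path g m, g 0%N = u & g m = v].

Definition path_cat (T : Type) (g : nat -> T) (m : nat) (h : nat -> T) :
    nat -> T :=
  fun i => if (i <= m)%N then g i else h (i - m)%N.

Lemma path_catl (T : Type) (g h : nat -> T) m i :
  (i <= m)%N -> path_cat g m h i = g i.
Proof. by rewrite /path_cat => ->. Qed.

Lemma path_catr (T : Type) (g h : nat -> T) m i :
  g m = h 0%N -> path_cat g m h (m + i) = h i.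
Proof.
move=> gh; rewrite /path_cat -[X in (_ <= X)%N]addn0 leq_add2l leqn0.
by case: eqP => [->|_]; rewrite ?addn0 // addKn.
Qed.

Section Walks.
Variables (G : graph).

Lemma simplicial_path_cat (g h : nat -> vert G) m k :
  simplicial_path g m -> simplicial_path h k -> g m = h 0%N ->
  simplicial_path (path_cat g m h) (m + k).
Proof.
move=> gp hp gh i ik; case: (ltnP i m) => im.
  by rewrite !path_catl //; [exact: gp|exact: ltnW].
rewrite -(subnKC im) -addnS !path_catr //; apply: hp.
by rewrite ltn_subLR.
Qed.

Lemma simplicial_path_leq (g : nat -> vert G) m k :
  (k <= m)%N -> simplicial_path g m -> simplicial_path g k.
Proof. by move=> km gp i ik; apply: gp; apply: leq_trans km. Qed.

Lemma walk0 (u : vert G) : walk 0 u u.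
Proof. by exists (fun=> u). Qed.

Lemma walk1 (u v : vert G) : Defs.adjacent u v -> walk 1 u v.
Proof.
by move=> uv; exists (fun i => if i is 0 then u else v); split=> // -[].
Qed.

Lemma walk_cat m k (u v w : vert G) :
  walk m u v -> walk k v w -> walk (m + k) u w.
Proof.
move=> [g [gp g0 gm]] [h [hp h0 hk]]; exists (path_cat g m h); split.
- by apply: simplicial_path_cat => //; rewrite gm h0.
- by rewrite path_catl.
- by rewrite path_catr // gm h0.
Qed.

Lemma walkS m (u w : vert G) :
  walk m.+1 u w -> exists2 v, walk m u v & Defs.adjacent v w.
Proof.
move=> [g [gp g0 gm]]; exists (g m); last by rewrite -gm; apply: gp.
by exists g; split=> //; apply: simplicial_path_leq gp.
Qed.

Lemma simplicial_path_walk (g : nat -> vert G) m i j :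
  simplicial_path g m -> (i <= j <= m)%N -> walk (j - i) (g i) (g j).
Proof.
move=> gp /andP [ij jm]; exists (fun k => g (i + k)%N).
split; rewrite ?addn0 ?subnKC // => k kj; rewrite addnS; apply: gp.
by apply: leq_trans jm; rewrite -ltn_subRL.
Qed.

Variable R : realType.

Lemma pl_path_ge0 (x y : gpoint R G) l : pl_path x y l -> 0 <= l.
Proof. by elim=> // *; rewrite addr_ge0. Qed.

Lemma pl_path_trans (x y z : gpoint R G) l l' :
  pl_path x y l -> pl_path y z l' -> pl_path x z (l + l').
Proof.
elim=> [u|e s t u v w k es et _ IH] h; first by rewrite add0r.
by rewrite -addrA; apply: PLCons es et (IH h).
Qed.

Lemma pl_path_seg (e : edge G) s t (x y : gpoint R G) :
  at_param e s x -> at_param e t y -> pl_path x y `|s - t|.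
Proof.
by move=> xs yt; have := PLCons xs yt (PLNil _); rewrite addr0.
Qed.

Lemma pl_path_sym (x y : gpoint R G) l : pl_path x y l -> pl_path y x l.
Proof.
elim=> [u|e s t u v w k es et _ IH]; first exact: PLNil.
by rewrite addrC distrC; apply: pl_path_trans IH _; apply: (@pl_path_seg e).
Qed.

Lemma pl_path_walk m (u v : vert G) :
  walk m u v -> pl_path (Vtx R u) (Vtx R v) m%:R.
Proof.
elim: m v => [|m IH] v.
  by move=> [g [_ <- <-]]; apply: PLNil.
move=> /walkS [w /IH uw [e we]]; rewrite -natr1; apply: pl_path_trans uw _.
case: we => -[<- <-].
  have := @pl_path_seg e 0 1 _ _ (AtSrc R e) (AtTgt R e).
  by rewrite sub0r normrN normr1.
have := @pl_path_seg e 1 0 _ _ (AtTgt R e) (AtSrc R e).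
by rewrite subr0 normr1.
Qed.

(* The induction also has to follow paths that start inside an edge: such a
   path leaves the edge at one of its two ends. *)
Lemma walk_pl_path (u v : vert G) l :
  pl_path (Vtx R u) (Vtx R v) l -> exists2 m : nat, walk m u v & m%:R <= l.
Proof.
pose leaves (e : edge G) (t l : R) :=
  (exists2 m : nat, walk m (src e) v & m%:R + t <= l) \/
  (exists2 m : nat, walk m (tgt e) v & m%:R + (1 - t) <= l).
pose Q (x : gpoint R G) (l : R) := match x with
  | Vtx u => exists2 m : nat, walk m u v & m%:R <= l
  | Inner e t _ => leaves e t l
  end.
have leavesP e t y k : at_param e t y -> Q y k -> leaves e t k.
  case=> [[m w mk]|[m w mk]|//]; [left|right]; exists m => //; lra.
have QP e s t x k : at_param e s x -> leaves e t k -> Q x (`|s - t| + k).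
  have := ler_norm (s - t); have := ler_norm (t - s); rewrite (distrC t s).
  move=> h1 h2 xs; case: xs h1 h2 => [||s' ?] h1 h2 [] [m w mk] /=.
  - by exists m => //; lra.
  - exists (1 + m)%N; last by rewrite natrD; lra.
    by apply: walk_cat w; apply: walk1; exists e; left.
  - exists (1 + m)%N; last by rewrite natrD; lra.
    by apply: walk_cat w; apply: walk1; exists e; right.
  - by exists m => //; lra.
  - by left; exists m => //; lra.
  - by right; exists m => //; lra.
suff H x z k : pl_path x z k -> z = Vtx R v -> Q x k by move=> /H; apply.
elim=> [y ->|e s t x' y' z' k' xs yt _ IH zv].
  by exists 0%N => //; apply: walk0.
by apply: QP xs _; apply: leavesP yt _; apply: IH.
Qed.

Lemma gdist_le (x y : gpoint R G) l : pl_path x y l -> gdist x y <= l.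
Proof.
move=> xy; apply: ge_inf => //; exists 0 => k; exact: pl_path_ge0.
Qed.

Hypothesis G_connected : connected_graph G.

Lemma pl_path_vertex (x : gpoint R G) :
  exists u, exists2 l, pl_path x (Vtx R u) l & l <= 1.
Proof.
case: x => [u|e t t01]; first by exists u, 0 => //; apply: PLNil.
exists (src e), `|t - 0|; last by rewrite subr0 ger0_norm; lra.
exact: pl_path_seg (AtInner e t01) (AtSrc R e).
Qed.

Lemma pl_path_exists (x y : gpoint R G) : exists l, pl_path x y l.
Proof.
have [u [l xu _]] := pl_path_vertex x; have [v [l' yv _]] := pl_path_vertex y.
have [g [m [gp g0 gm]]] := G_connected.2 u v.
exists (l + (m%:R + l')); apply: pl_path_trans xu _.
apply: pl_path_trans (pl_path_sym yv); apply: pl_path_walk.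
by exists g.
Qed.

Lemma gdist_lt (x y : gpoint R G) s :
  gdist x y < s -> exists2 l, pl_path x y l & l < s.
Proof.
by move=> /(inf_lt (pl_path_exists x y)) [l ? ?]; exists l.
Qed.

Lemma gdist_pseudometric : pseudometric (@gdist R G).
Proof.
split=> [x|x y|x y z].
- apply/eqP; rewrite eq_le gdist_le ?andbT; last exact: PLNil.
  by apply: lb_le_inf; [exact: pl_path_exists|move=> k; exact: pl_path_ge0].
- by congr inf; apply/seteqP; split=> l; apply: pl_path_sym.
- apply/ler_addgt0Pl => eps eps0.
  have [|l xy lt] := @gdist_lt x y (gdist x y + eps / 2); first by lra.
  have [|k yz kt] := @gdist_lt y z (gdist y z + eps / 2); first by lra.
  by have := gdist_le (pl_path_trans xy yz); lra.
Qed.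

Lemma gdist_ge0 (x y : gpoint R G) : 0 <= gdist x y.
Proof. exact: pseudometric_ge0 gdist_pseudometric x y. Qed.

Lemma gdist_vertex (x : gpoint R G) : exists u, gdist x (Vtx R u) <= 1.
Proof.
have [u [l /gdist_le xu l1]] := pl_path_vertex x.
by exists u; apply: le_trans l1.
Qed.

Lemma gdist_walk m (u v : vert G) :
  walk m u v -> gdist (Vtx R u) (Vtx R v) <= m%:R.
Proof. by move=> /pl_path_walk /gdist_le. Qed.

Lemma walk_gdist (u v : vert G) s : gdist (Vtx R u) (Vtx R v) < s ->
  exists2 m : nat, walk m u v & m%:R < s.
Proof.
move=> /gdist_lt [l /walk_pl_path [m uv ml] ls].
by exists m => //; apply: le_lt_trans ls.
Qed.

End Walks.

Lemma walk_map (G G' : graph) (f : vert G -> vert G') :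
  (forall u v, Defs.adjacent u v -> Defs.adjacent (f u) (f v)) ->
  forall m u v, walk m u v -> walk m (f u) (f v).
Proof.
by move=> fA m u v [g [gp <- <-]]; exists (f \o g); split=> // i /gp /fA.
Qed.

Lemma gdist_map (R : realType) (G G' : graph) (f : vert G -> vert G') :
  connected_graph G -> connected_graph G' ->
  (forall u v, Defs.adjacent u v -> Defs.adjacent (f u) (f v)) ->
  forall u v, gdist (Vtx R (f u)) (Vtx R (f v)) <= gdist (Vtx R u) (Vtx R v).
Proof.
move=> Gc G'c fA u v; apply/ler_addgt0Pr => eps eps0.
have [|m /(walk_map fA) uv ms] := @walk_gdist _ R Gc u v
  (gdist (Vtx R u) (Vtx R v) + eps); first lra.
by have := gdist_walk R uv; lra.
Qed.

(** A shortest walk repeats no vertex, since the loop between two visits could be cut out. This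
    injectivity later gives efficiency. *)
Lemma geodesic_walk (G : graph) (j : nat) (u v : vert G) :
  (exists2 m, (m <= j)%N & walk m u v) ->
  exists g m, [/\ (m <= j)%N, simplicial_path g m, g 0%N = u, g m = v &
    forall i i', (i <= m)%N -> (i' <= m)%N -> g i = g i' -> i = i'].
Proof.
move=> [m0 m0j w0].
have ex : exists m, `[< walk m u v >] by exists m0; apply/asboolP.
case: (ex_minnP ex) => m /asboolP [g [gp g0 gm]] mmin; exists g, m; split=> //.
  by apply: leq_trans m0j; apply: mmin; apply/asboolP.
have lt_neq i i' : (i < i')%N -> (i' <= m)%N -> g i <> g i'.
  move=> ii' i'm gii'.
  have /mmin : `[< walk (i + (m - i')) u v >].
    apply/asboolP; apply: (@walk_cat _ _ _ _ (g i)).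
      rewrite -g0 -{1}(subn0 i); apply: (simplicial_path_walk gp).
      by rewrite /= (leq_trans (ltnW ii')).
    rewrite gii' -gm; apply: (simplicial_path_walk gp).
    by rewrite i'm leqnn.
  by rewrite leqNgt -{2}(subnKC i'm) ltn_add2r ii'.
move=> i i' im i'm gii'; case: (ltngtP i i') => // ii'.
  by case: (lt_neq _ _ ii' i'm).
by case: (lt_neq _ _ ii' im).
Qed.

Lemma nat_bound (R : realType) (s : R) : exists N : nat, s < N%:R.
Proof.
exists (Num.bound `|s|); apply: le_lt_trans (ler_norm s) _.
exact: archi_boundP.
Qed.

(** * Electrification and bounded penetration *)

Section Electrification.
Variables (R : realType) (G : graph) (C : Type) (H : C -> subgraph G).
Hypothesis G_connected : connected_graph G.
Hypothesis H_connected : forall c : C, connected_graph (H c).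
Local Notation EG := (electrification H).
Local Notation inG := (inl : vert G -> vert EG).
Local Notation cone := (inr : C -> vert EG).
Local Notation d u v := (gdist (Vtx R u) (Vtx R v)).

Lemma adjacent_inG (u v : vert G) :
  Defs.adjacent u v -> Defs.adjacent (inG u) (inG v).
Proof. by move=> [e [[<- <-]|[<- <-]]]; exists (inl e); [left|right]. Qed.

Lemma adjacent_subgraph c (a b : vert (H c)) :
  Defs.adjacent a b -> Defs.adjacent (sval a) (sval b).
Proof. by move=> [e [[<- <-]|[<- <-]]]; exists (sval e); [left|right]. Qed.

Lemma adjacent_to_cone c (a : vert (H c)) :
  Defs.adjacent (inG (sval a)) (cone c).
Proof.
by exists (inr (existT (fun c => vert (H c)) c a)); left.
Qed.

Lemma adjacent_from_cone c (a : vert (H c)) :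
  Defs.adjacent (cone c) (inG (sval a)).
Proof.
by exists (inr (existT (fun c => vert (H c)) c a)); right.
Qed.

Lemma adjacent_coneP (x : vert EG) c :
  Defs.adjacent x (cone c) \/ Defs.adjacent (cone c) x ->
  exists a : vert (H c), x = inG (sval a).
Proof.
by case=> -[[e|[c' a]] /= [] [h1 h2]] //; case: h2 a h1 => -> a <-; exists a.
Qed.

Lemma electrification_connected : connected_graph EG.
Proof.
have [[v0] Gc] := G_connected; split; first exact: inhabits (inG v0).
have toG (x : vert EG) : exists u, (exists m, walk m x (inG u)) /\
    exists m, walk m (inG u) x.
  case: x => [u|c]; first by exists u; split; exists 0%N; apply: walk0.
  have [[a] _] := H_connected c; exists (sval a); split; exists 1%N.
    by apply: walk1; apply: adjacent_from_cone.
  by apply: walk1; apply: adjacent_to_cone.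
move=> x y; have [u [[m xu] _]] := toG x; have [v [_ [m' vy]]] := toG y.
have [g [k gP]] := Gc u v.
have uv : walk k (inG u) (inG v) by apply: (walk_map adjacent_inG); exists g.
have [h hP] := walk_cat (walk_cat xu uv) vy.
by exists h, (m + k + m')%N.
Qed.

Lemma gdist_electrification_le (u v : vert G) :
  gdist (Vtx R (inG u)) (Vtx R (inG v)) <= d u v.
Proof.
exact: (@gdist_map R _ EG inG G_connected electrification_connected
  adjacent_inG).
Qed.

Lemma gdist_subgraph_ge c (a b : vert (H c)) :
  d (sval a) (sval b) <= gdist (Vtx R a) (Vtx R b).
Proof.
exact: (@gdist_map R _ _ _ (H_connected c) G_connected (@adjacent_subgraph c)).
Qed.

(** For length at most [L] the lower bound is at most 0, so bounded penetration applies to all short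
    paths. *)
Lemma short_quasi_geodesic (L : nat) (g : nat -> vert EG) m :
  (m <= L)%N -> (0 < L)%N -> simplicial_path g m ->
  quasi_geodesic (L%:R : R) g m.
Proof.
move=> mL L0 gp i j ijm.
have L1 : 1 <= L%:R :> R by rewrite ler1n.
have jiL : (j - i)%:R <= L%:R :> R.
  case/andP: ijm => _ jm; rewrite ler_nat; apply: leq_trans mL.
  by apply: leq_trans jm; apply: leq_subr.
apply/andP; split.
  apply: le_trans (gdist_ge0 electrification_connected _ _).
  rewrite subr_le0 ler_pdivrMr; last lra.
  by apply: le_trans jiL _; rewrite ler_peMr //; lra.
have := gdist_walk R (simplicial_path_walk gp ijm).
have : (j - i)%:R <= L%:R * (j - i)%:R :> R by rewrite ler_peMl.
lra.
Qed.

Hypothesis bp : bounded_penetration R H.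

(** The two-edge path from [a] to [b] through the cone vertex is compared with a short walk in [G].
    The latter avoids all cone vertices, so bounded penetration forces the distance in [H c] below
    [p]. *)
Lemma subgraph_coarse_embedding (s : R) :
  exists2 t : R, 0 <= t & forall c (a b : vert (H c)),
    d (sval a) (sval b) <= s -> gdist (Vtx R a) (Vtx R b) <= t.
Proof.
have [N sN] := nat_bound (s + 1).
have [|p p0 hp] := @bp (N + 2)%:R; first by rewrite ltr1n addn2.
exists p; first exact: ltW.
move=> c a b ab; rewrite leNgt; apply/negP => /ltW pab.
have [|m [h [hp' h0 hm]] ms] := @walk_gdist _ R G_connected (sval a) (sval b)
  (s + 1); first lra.
have mN : (m <= N)%N by rewrite ltnW // -(ltr_nat R); lra.
pose g i :=
  match i with 0 => inG (sval a) | 1 => cone c | _ => inG (sval b) end.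
have gE : efficient_quasi_geodesic ((N + 2)%:R : R) g 2.
  have gp : simplicial_path g 2.
    case=> [|[|//]] _; [exact: adjacent_to_cone|exact: adjacent_from_cone].
  split=> //; first by move=> c' [|[|i]] [|[|j]].
  by apply: short_quasi_geodesic => //; rewrite addn2.
have [] := hp g 2 c 0%N a b gE isT erefl erefl erefl pab (inG \o h) m.
- have gp : simplicial_path (inG \o h) m by move=> i /hp' /adjacent_inG.
  split=> //; apply: short_quasi_geodesic => //; last by rewrite addn2.
  exact: leq_trans mN (leq_addr _ _).
- by rewrite /= h0.
- by rewrite /= hm.
by move=> [].
Qed.

(** The vertex [h i] is visited at time [m + i + 1]. *)
Definition cone_path (g : nat -> vert EG) m c (h : nat -> vert G) :
    nat -> vert EG :=
  path_cat g m (fun i => if i is i'.+1 then inG (h i') else cone c).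

Lemma cone_path_efficient (L : nat) g m c (a : vert (H c)) h k :
  (m + k.+1 <= L)%N -> simplicial_path g m -> g m = cone c ->
  (forall i i', (i <= m)%N -> (i' <= m)%N -> g i = g i' -> i = i') ->
  simplicial_path h k -> h 0%N = sval a ->
  efficient_quasi_geodesic (L%:R : R) (cone_path g m c h) (m + k.+1).
Proof.
move=> mkL gp gm ginj hp h0.
have pp : simplicial_path (cone_path g m c h) (m + k.+1).
  apply: simplicial_path_cat => // -[|i] ik.
    by rewrite h0; apply: adjacent_from_cone.
  by apply: adjacent_inG; apply: hp.
split=> //; last first.
  by apply: short_quasi_geodesic => //; apply: leq_trans mkL; rewrite addnS.
have cm c' i : cone_path g m c h i = cone c' -> (i <= m)%N.
  case: (leqP i m) => // mi.
  rewrite /cone_path -(subnKC (ltnW mi)) path_catr //.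
  by move: mi; rewrite -subn_gt0; case: (i - m)%N.
move=> c' i j _ _ ic jc; have im := cm _ _ ic; have jm := cm _ _ jc.
by apply: ginj => //; move: ic jc; rewrite /cone_path !path_catl // => -> ->.
Qed.

Definition eball (v0 : vert G) (j : nat) : set (vert EG) :=
  [set x | exists2 m, (m <= j)%N & walk m (inG v0) x].

(** Two paths from [v0] to [a'] are compared: one through the cone of [c], then [a] and a short walk
    in [G]; the other through the cone of [c'] straight to [a']. The first reaches its cone from a
    vertex [b] of the ball, far from [a], so the second must also pass through the cone of [c]. *)
Lemma subgraphs_disjoint_far (j : nat) (r : R) : exists2 p : R, 0 < p &
  forall v0 c c' (a : vert (H c)) (a' : vert (H c')),
    eball v0 j (cone c) -> eball v0 j (cone c') ->
    d (sval a) (sval a') <= r ->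
    (forall y, eball v0 j (inG y) -> p < d (sval a) y) -> c = c'.
Proof.
have [N sN] := nat_bound (r + 1).
pose L := (j + N.+2)%N.
have [|p p0 hp] := @bp L%:R; first by rewrite ltr1n /L !addnS.
exists p => // v0 c c' a a' vc vc' aa' far.
have [|k [h [hp' h0 hk]] ks] := @walk_gdist _ R G_connected (sval a) (sval a')
  (r + 1); first lra.
have kN : (k <= N)%N by rewrite ltnW // -(ltr_nat R); lra.
have [g [m [mj gp g0 gm ginj]]] := geodesic_walk vc.
have [g' [m' [m'j gp' g'0 gm' ginj']]] := geodesic_walk vc'.
have ballP (f : nat -> vert EG) n i : simplicial_path f n -> f 0%N = inG v0 ->
    (i <= n)%N -> (n <= j)%N -> eball v0 j (f i).
  move=> fp f0 i_n nj; exists i; first exact: leq_trans nj.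
  by exists f; split=> //; apply: simplicial_path_leq fp.
have [m1 m1E] : exists m1, m = m1.+1.
  by case: m gm {mj gp ginj} => [|m1 _]; [rewrite g0|exists m1].
have [b gb] : exists b : vert (H c), g m1 = inG (sval b).
  by apply: adjacent_coneP; left; rewrite -gm m1E; apply: gp; rewrite m1E.
have gE : efficient_quasi_geodesic (L%:R : R) (cone_path g m c h) (m + k.+1).
  apply: (@cone_path_efficient _ _ _ _ a) => //.
  by rewrite leq_add // !ltnS ltnW.
have g'E : efficient_quasi_geodesic (L%:R : R)
    (cone_path g' m' c' (fun=> sval a')) (m' + 1).
  by apply: (@cone_path_efficient _ _ _ _ a') => //; rewrite leq_add.
have pab : p <= gdist (Vtx R b) (Vtx R a).
  apply: ltW; apply: lt_le_trans (gdist_subgraph_ge b a).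
  have [_ ds _] := gdist_pseudometric R G_connected.
  rewrite ds; apply: far; rewrite -gb; apply: (ballP g m) => //.
  by rewrite m1E.
have [||||||[k' k'm' k'c] hclose] :=
  hp (cone_path g m c h) _ c m1 b a gE _ _ _ _ pab
  (cone_path g' m' c' (fun=> sval a')) _ g'E.
- by rewrite m1E addSn addnS !ltnS leq_addr.
- by rewrite /cone_path path_catl // m1E.
- by rewrite /cone_path path_catl -?m1E.
- by rewrite /cone_path -[m1.+2]addn1 -m1E path_catr //= h0.
- by rewrite /cone_path !path_catl // g0.
- by rewrite /cone_path !path_catr //= hk.
(* Before time [m'], the second path would leave the cone of [c] at a vertex [b1] of the ball within
   [p] of [a]; after it, the path is in [G]. At time [m'] the cone is that of [c']. *)
case: (ltngtP k' m') => km.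
- have {}k'c : g' k' = cone c.
    by move: k'c; rewrite /cone_path path_catl // ltnW.
  have [k1 k1E] : exists k1, k' = k1.+1.
    by case: k' k'c {k'm' km} => [|k1 _]; [rewrite g'0|exists k1].
  have [a1 ga1] : exists a1 : vert (H c), g' k1 = inG (sval a1).
    apply: adjacent_coneP; left; rewrite -k'c k1E; apply: gp'.
    by apply: ltn_trans km; rewrite k1E.
  have [b1 gb1] : exists b1 : vert (H c), g' k1.+2 = inG (sval b1).
    by apply: adjacent_coneP; right; rewrite -k'c k1E; apply: gp'; rewrite -k1E.
  have k1m : (k1.+2 <= m')%N by rewrite -k1E.
  have [||||_ ab1] := hclose k1 a1 b1.
  + by rewrite addn1 ltnW.
  + by rewrite /cone_path path_catl // ltnW // ltnW.
  + by rewrite /cone_path path_catl -?k1E // ltnW.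
  + by rewrite /cone_path path_catl.
  have := far (sval b1); rewrite -gb1 => /(_ (ballP _ _ _ gp' g'0 k1m m'j)) pb1.
  by have ab1' := gdist_subgraph_ge a b1; exfalso; lra.
- have km1 : k' = (m' + 1)%N by apply/eqP; rewrite eqn_leq k'm' addn1 km.
  by move: k'c; rewrite km1 /cone_path path_catr.
- by move: k'c; rewrite km /cone_path path_catl // gm' => -[].
Qed.

End Electrification.

(** * Pullbacks, and colourings of vertices versus points *)

Lemma pullback_pseudometric (R : realType) (X Y : Type) (f : X -> Y)
    (d : Y -> Y -> R) :
  pseudometric d -> pseudometric (fun x y => d (f x) (f y)).
Proof. by case=> d0 ds dt; split=> *; [exact: d0|exact: ds|exact: dt]. Qed.

(** The scale [r + 1] is positive even for [r = 0], and the absolute value makes the bound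
    nonnegative whatever the sign of [D]. *)
Lemma asdim_cover_pullback_colours (R : realType) (X Y : Type) (f : X -> Y)
    (d : Y -> Y -> R) (n k : nat) (r D : R) :
  pseudometric d -> 0 <= r -> asdim_cover d n (k.+1%:R * (r + 1)) D ->
  exists2 W : 'I_k -> set X, colours n setT W & forall i,
    bounded_chains (fun x y => d (f x) (f y)) r
      (`|D| + 2 * (k.+1%:R * (r + 1))) (W i).
Proof.
move=> dP r0 /(asdim_cover_colours dP) [|W Wc Wb]; first lra.
exists (fun i => f @^-1` W i).
  by apply: sub_colours Wc => x _; exists (f x).
move=> i x y xy; apply: le_trans (_ : D + 2 * (k.+1%:R * (r + 1)) <= _).
  apply: (Wb i); elim: xy => [u Wu|u v w Wu uv _ IH]; first exact: ChainNil.
  by apply: ChainCons IH => //; lra.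
by rewrite lerD2r ler_norm.
Qed.

Lemma asdim_le_pullback_colourable (R : realType) (X Y : Type) (f : X -> Y)
    (d : Y -> Y -> R) (n k : nat) :
  pseudometric d -> asdim_le d n ->
  colourable (fun x y => d (f x) (f y)) k n [set setT].
Proof.
move=> dP dn r r0.
have k0 : 0 < k.+1%:R * (r + 1) by rewrite mulr_gt0 //; lra.
have [D /(asdim_cover_pullback_colours f dP r0)[W Wc Wb]] := dn _ k0.
exists (`|D| + 2 * (k.+1%:R * (r + 1))); first by have := normr_ge0 D; lra.
by move=> _ ->; exists W.
Qed.

Definition vdist (R : realType) (G : graph) (u v : vert G) : R :=
  gdist (Vtx R u) (Vtx R v).

Lemma vdist_pseudometric (R : realType) (G : graph) :
  connected_graph G -> pseudometric (@vdist R G).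
Proof. by move=> /(gdist_pseudometric R) /pullback_pseudometric; apply. Qed.

(** Every point is within 1 of a vertex, so the 1-thickenings of the vertex colours colour the
    metric graph. The scale is [2 * r] for the passage to covers plus [2 * 1] for the thickening. *)
Lemma vertex_colourable_asdim_le (R : realType) (G : graph) (n : nat) :
  connected_graph G -> colourable (@vdist R G) n.+1 n [set setT] ->
  asdim_le (@gdist R G) n.
Proof.
move=> Gc Gn r r0; have gP := gdist_pseudometric R Gc.
have r'0 : 0 <= 2 * r + 2 * 1 by lra.
have [D D0 /(_ _ erefl)[W Wc Wb]] := Gn _ r'0; exists (D + 2 * 1).
pose V i : set (gpoint R G) := [set Vtx R u | u in W i].
apply: (colours_asdim_cover gP (W := fun i => thickening (@gdist R G) 1 (V i))).
- by [].
- apply: sub_colours Wc => x _; have [u xu] := gdist_vertex x.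
  by exists u => // i Wu; exists (Vtx R u) => //; exists u.
- move=> i; apply: bounded_chains_thickening => // x y xy.
  suff [u [v [<- <- /Wb]]] : exists u v, [/\ Vtx R u = x, Vtx R v = y &
      chain (@vdist R G) (2 * r + 2 * 1) (W i) u v] by [].
  elim: xy => [_ [u Wu <-]|_ y' z [u Wu <-] uv _ [v [w [vy wz vw]]]].
    by exists u, u; split=> //; apply: ChainNil.
  by exists u, w; split=> //; apply: ChainCons vw => //; rewrite /vdist vy.
Qed.

(** * Balls of the electrification, seen in the graph *)

Section Balls.
Variables (R : realType) (G : graph) (C : Type) (H : C -> subgraph G) (n : nat).
Hypothesis G_connected : connected_graph G.
Hypothesis H_connected : forall c : C, connected_graph (H c).
Hypothesis bp : bounded_penetration R H.
Hypothesis H_asdim : uniform_asdim_le (fun c : C => @gdist R (H c)) n.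
Local Notation EG := (electrification H).
Local Notation inG := (inl : vert G -> vert EG).
Local Notation cone := (inr : C -> vert EG).
Variable k : nat.

Lemma subgraph_colouring (t : R) : 0 <= t -> exists2 D, 0 <= D & forall c,
  exists2 W : 'I_k -> set (vert (H c)), colours n setT W
    & forall i, bounded_chains (@vdist R (H c)) t D (W i).
Proof.
move=> t0; have k0 : 0 < k.+1%:R * (t + 1) by rewrite mulr_gt0 //; lra.
have [D hD] := H_asdim k0.
exists (`|D| + 2 * (k.+1%:R * (t + 1))); first by have := normr_ge0 D; lra.
move=> c; have gP := gdist_pseudometric R (H_connected c).
by have [W Wc Wb] := asdim_cover_pullback_colours (@Vtx R (H c)) gP t0 (hD c);
  exists W.
Qed.

(** Such a set can be unbounded for [vdist]: two edges through a cone vertex join any two vertices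
    of [H c]. *)
Definition gball (v0 : vert G) (j : nat) : set (vert G) :=
  [set y | eball (H := H) v0 j (inG y)].

(* The part of the next ball away from the previous one lies in subgraphs
   [H c] which are far apart from each other there. *)
Lemma gball_colourable (j : nat) :
  colourable (@vdist R G) k n [set B | exists v0, B = gball v0 j].
Proof.
have dP := vdist_pseudometric R G_connected; have [d0 ds dt] := dP.
elim: j => [|j IH] r r0.
  exists 0 => // _ [v0 ->]; exists (fun=> [set v0]).
    move=> y [m]; rewrite leqn0 => /eqP -> [g [_ -> [<-]]].
    by rewrite eq_card0 // => i; rewrite !inE; apply: negbF; apply/asboolP.
  move=> _ x y xy.
  by rewrite (chain_startW xy) (chain_endW xy) d0.
have [p p0 far_disjoint] :=
  subgraphs_disjoint_far G_connected H_connected bp j r.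
have [t t0 embed] := subgraph_coarse_embedding G_connected H_connected bp r.
have [DH DH0 hH] := subgraph_colouring t0.
(* [p'] exceeds [p], for [far_disjoint], and is at least 1, so that neighbours in [G] of the smaller
   ball lie in its thickening. *)
pose p' := p + 1.
(* [2 * p'] pays for the thickening, the rest for the union with the far part. *)
have s0 : 0 <= (DH + 2 * r) + 2 * p' by rewrite /p'; lra.
have [D D0 hD] := IH _ s0.
have D'0 : 0 <= D + 2 * p' by rewrite /p'; lra.
exists (D + 2 * p' + 2 * (DH + r)); first lra.
move=> _ [v0 ->].
have [B Bc Bb] := hD _ (ex_intro _ v0 erefl).
have hW' c : exists W : 'I_k -> set (vert (H c)),
    colours n setT W /\ forall i, bounded_chains (@vdist R (H c)) t DH (W i).
  by have [W ? ?] := hH c; exists W.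
pose W c := projT1 (cid (hW' c)); have hW c := projT2 (cid (hW' c)).
pose far : set (vert G) := [set x | forall y, gball v0 j y -> p' < vdist R x y].
pose A i : set (vert G) := [set x | far x /\ exists c (a : vert (H c)),
  [/\ eball (H := H) v0 j (cone c), sval a = x & W c i a]].
exists (fun i => A i `|` thickening (@vdist R G) p' (B i)).
  move=> x xj; have [fx|nfx] := pselect (far x).
    (* The vertex before [x] on a walk from [v0] must be a cone vertex, as otherwise [x] would be
       within 1 of the smaller ball. *)
    have [c cj [a ax]] : exists2 c, eball (H := H) v0 j (cone c) &
        exists a : vert (H c), sval a = x.
      have nx y : gball v0 j y -> vdist R x y <= p' -> False.
        by move=> /fx; rewrite ltNge => /negP.
      case: xj => -[|m] mj.
        move=> w; case: (nx x); last by rewrite d0 /p'; lra.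
        by exists 0%N.
      move=> /walkS [[y|c] wy yx].
        case: (nx y); first by exists m.
        have [e exy] : Defs.adjacent x y.
          case: yx => -[e|q] /= [] [] // [h1] [h2]; exists e; [right|left];
            by split.
        have : walk 1 x y by apply: walk1; exists e.
        by move=> /(gdist_walk R); rewrite /vdist /p'; lra.
      exists c; first by exists m.
      have [a [xa]] := @adjacent_coneP _ _ _ _ c (or_intror yx).
      by exists a.
    have [Wc _] := hW c.
    suff /(_ x erefl) : colours n [set x]
      (fun i => A i `|` thickening (@vdist R G) p' (B i)) by [].
    apply: sub_colours Wc => _ ->; exists a => // i Wa; left; split=> //.
    by exists c, a.
  have [y yB xy] : exists2 y, gball v0 j y & vdist R x y <= p'.
    apply: contrapT => nE; apply: nfx => y yB; rewrite ltNge; apply/negP => xy.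
    by apply: nE; exists y.
  suff /(_ x erefl) : colours n [set x]
    (fun i => A i `|` thickening (@vdist R G) p' (B i)) by [].
  apply: sub_colours Bc => _ ->; exists y => // i By; right.
  by exists y.
move=> i; apply: bounded_chainsU => //; last exact: bounded_chains_thickening.
move=> x z xz; have [fx [c [a [cj ax Wa]]]] := chain_startW xz.
(* Consecutive points of the chain are at most [r] apart and far from the smaller ball, so their
   subgraphs coincide; by the coarse embedding the chain lifts to a [t]-chain in one [H c]. *)
suff [b bz /(hW c).2 ab] : exists2 b : vert (H c), sval b = z &
    chain (@vdist R (H c)) t (W c i) a b.
  rewrite -ax -bz; apply: le_trans ab.
  exact: gdist_subgraph_ge.
elim: xz a {fx} ax Wa => [u _|u v w [fu _] uv vw IHc] a ax Wa.
  by exists a => //; apply: ChainNil.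
have [fv [c' [a' [c'j a'v Wa']]]] := chain_startW vw.
have cc' : c = c'.
  apply: (far_disjoint v0 _ _ a a') => //; first by rewrite ax a'v.
  by move=> y yB; rewrite ax; have := fu y yB; rewrite /p' /vdist; lra.
case: c' / cc' a' c'j a'v Wa' => a' _ a'v Wa'.
have [b bw a'b] := IHc a' a'v Wa'; exists b => //; apply: ChainCons a'b => //.
by apply: embed; rewrite ax a'v.
Qed.

End Balls.

(** * The inequality between the dimensions *)

Lemma asdim_le_electrification (R : realType) (G : graph) (C : Type)
    (H : C -> subgraph G) (m n : nat) :
  connected_graph G -> (forall c, connected_graph (H c)) ->
  bounded_penetration R H ->
  uniform_asdim_le (fun c : C => @gdist R (H c)) n ->
  asdim_le (@gdist R (electrification H)) m ->
  asdim_le (@gdist R G) (m + n).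
Proof.
move=> Gc Hc bp Hn Em; have Ec := electrification_connected Gc Hc.
have EP := gdist_pseudometric R Ec.
apply: vertex_colourable_asdim_le => //.
pose f (u : vert G) := Vtx R (inl u : vert (electrification H)).
pose e (u v : vert G) := gdist (f u) (f v).
apply: (hurewicz (e := e)).
- exact: vdist_pseudometric.
- exact: (pullback_pseudometric f EP).
- exact: gdist_electrification_le.
- by move=> k'; apply: (asdim_le_pullback_colourable f).
(* A nonempty set of [e]-diameter at most [E] lies in the ball of radius [N] about any of its
   vertices, so the fibres inherit the colourings of balls. *)
move=> E; have [N EN] := nat_bound (E + 1).
move=> r r0; have [D D0 hD] := gball_colourable Gc Hc bp Hn (m + n).+1 N r0.
exists D => // Z ZE; have [[v0 Zv0]|Z0] := pselect (exists v, Z v).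
  have [W Wc Wb] := hD _ (ex_intro _ v0 erefl); exists W => // x Zx; apply: Wc.
  have [|k vx kE] := @walk_gdist _ R Ec (inl v0) (inl x) (E + 1).
    by have := ZE v0 x Zv0 Zx; rewrite /e /f; lra.
  by exists k => //; rewrite ltnW // -(ltr_nat R); lra.
exists (fun=> set0) => [x Zx|i x y /chain_startW //].
by case: Z0; exists x.
Qed.

Theorem theorem1 (R : realType) (G : graph) (C : Type) (H : C -> subgraph G)
    (n : nat)
    (C_countable : countable [set: C])
    (G_connected : connected_graph G)
    (G_hyperbolic : gromov_hyperbolic (@gdist R G))
    (H_complete : forall c : C, complete_subgraph (H c))
    (H_connected : forall c : C, connected_graph (H c))
    (G_rel_hyperbolic : relatively_hyperbolic R H)
    (H_hyperbolic : exists2 delta : R, 0 < delta &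
       forall c : C, hyperbolic_with (@gdist R (H c)) delta)
    (H_asdim : uniform_asdim_le (fun c : C => @gdist R (H c)) n) :
  (asdim (@gdist R G) <= asdim (@gdist R (electrification H)) + n%:R%:E + 1)%E.
Proof.
have [_ bp] := G_rel_hyperbolic.
(* With the finite term [n + 1] on the left, it suffices to compare with each [m] in the set whose
   infimum is taken; an empty set, with infimum +oo, leaves nothing to check. *)
rewrite -addeA -leeBlDr; last by rewrite -EFinD.
apply/ereal_infP => _ [m Em <-].
rewrite leeBlDr; last by rewrite -EFinD.
apply: (@le_trans _ _ ((m + n)%:R)%:E).
  apply: ereal_inf_lbound; exists (m + n)%N => //=.
  exact: asdim_le_electrification bp H_asdim Em.
by rewrite -!EFinD lee_fin natrD; lra.
Qed.
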